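(* Let $A$ be a (square, complex) partial isometry of rank three with $\operatorname{def}A=1$. Then $C(A)$ contains a circle (of positive radius) if and only if $A$ is unitarily reducible with one of the blocks equal to $J_2=\begin{bmatrix}0&1\\0&0\end{bmatrix}$, i.e. $A$ is unitarily similar to a block diagonal matrix one of whose diagonal blocks is $J_2$. If this is the case, then this circle has radius $1/2$ and there are no other circles contained in $C(A)$. In particular, $W(A)$ is not a circular disk.
   Context: A matrix $A$ is a partial isometry if $\|Ax\|=\|x\|$ for all $x\perp\ker A$. $\operatorname{def}A$ (the defect of $A$) is the defect of the eigenvalue $0$ of $A$: its algebraic multiplicity minus its geometric multiplicity. $W(A)=\{\langle Ax,x\rangle:\|x\|=1\}$ is the numerical range. Put $\operatorname{Re}X=(X+X^* )/2$. The Kippenhahn polynomial of $A\in\mathbb C^{n\times n}$ is $P_A(\lambda,\theta)=\det(\operatorname{Re}(e^{i\theta}A)-\lambda I)$. With $\lambda_1(\theta),\dots,\lambda_n(\theta)$ its roots in $\lambda$, the Kippenhahn curve $C(A)$ is the envelope of the family of lines $\{e^{-i\theta}(\lambda_j(\theta)+i\mathbb R):\theta\in(-\pi,\pi],\ j=1,\dots,n\}$. $\mathcal C_{a,r}$ is the circle of radius $r>0$ centered at $a$, and $\mathcal C_r=\mathcal C_{0,r}$. The containment $C(A)\supset\mathcal C_r$ holds if and only if, for all $\theta$, $P_A(\lambda,\theta)$ is divisible by $\lambda^2-r^2$ as a polynomial in $\lambda$; and $C(A)\supset\mathcal C_{a,r}$ if and only if $C(A-aI)\supset\mathcal C_r$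 (these may be taken as definitions). *)

(* Defs.v *)
From mathcomp Require Import all_boot all_order all_algebra.
From mathcomp Require Import complex.
From mathcomp Require Import boolp classical_sets reals trigo.

Set Implicit Arguments.
Unset Strict Implicit.
Unset Printing Implicit Defensive.

Import Order.TTheory GRing.Theory Num.Theory.

Local Open Scope ring_scope.
Local Open Scope sesquilinear_scope.
Local Open Scope complex_scope.

Section Definitions.

Variable R : realType.
Local Notation C := R[i].

(* Vectors are columns; the inner product is linear in its first argument. *)
Definition inner n (x y : 'cV[C]_n) : C := (y^t* *m x) 0 0.

Definition vnorm n (x : 'cV[C]_n) : C := sqrtC (inner x x).

Definition partial_isometry n (A : 'M[C]_n) : Prop :=
  forall x : 'cV[C]_n,
    (forall y : 'cV[C]_n, A *m y = 0 -> inner x y = 0) ->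
    vnorm (A *m x) = vnorm x.

Definition alg_mult n (A : 'M[C]_n) (a : C) : nat := mup a (char_poly A).

(* [eigenspace] consists of row vectors acting on the left, hence the
   transpose to obtain the column eigenvectors of A. *)
Definition geom_mult n (A : 'M[C]_n) (a : C) : nat := \rank (eigenspace A^T a).

Definition defect n (A : 'M[C]_n) : nat := (alg_mult A 0%R - geom_mult A 0%R)%N.

Definition numerical_range n (A : 'M[C]_n) : set C :=
  [set z | exists2 x : 'cV[C]_n, vnorm x = 1 & z = inner (A *m x) x]%classic.

Definition disk (a : C) (r : R) : set C := [set z | `|z - a| <= r%:C]%classic.

Definition circular_disk (W : set C) : Prop :=
  exists a : C, exists2 r : R, 0 < r & W = disk a r.

Definition Re_mx n (X : 'M[C]_n) : 'M[C]_n := 2^-1 *: (X + X^t*).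

Definition expi (t : R) : C := cos t +i* sin t.

Definition kippenhahn_poly n (A : 'M[C]_n) (t : R) : {poly C} :=
  \det (map_mx polyC (Re_mx (expi t *: A)) - 'X%:M).

(* C(A) contains the circle of radius r centered at a.  For a = 0 this is
   divisibility of P_A(., t) by 'X^2 - r^2 for every angle t; the general case
   is reduced to it by translation. *)
Definition curve_contains0 n (A : 'M[C]_n) (r : R) : Prop :=
  forall t : R, 'X^2 - ((r ^+ 2)%:C)%:P %| kippenhahn_poly A t.

Definition curve_contains n (A : 'M[C]_n) (a : C) (r : R) : Prop :=
  curve_contains0 (A - a%:M) r.

Definition curve_contains_circle n (A : 'M[C]_n) : Prop :=
  exists a : C, exists2 r : R, 0 < r & curve_contains A a r.

Definition J2 : 'M[C]_2 :=
  \matrix_(i < 2, j < 2) ((i == 0 :> nat) && (j == 1 :> nat))%:R.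

(* A is unitarily similar to a block diagonal matrix with at least two
   (nonempty, square) diagonal blocks, one of which is the m x m matrix J;
   the casts only identify propositionally equal dimensions. *)
Definition unitarily_reducible_with n (A : 'M[C]_n) m (J : 'M[C]_m) : Prop :=
  exists (k : nat) (p : 'I_k -> nat) (B : forall i, 'M[C]_(p i))
         (en : (\sum_(i < k) p i)%N = n) (U : 'M[C]_n),
    [/\ (1 < k)%N,
        (forall i, (0 < p i)%N),
        U \is unitarymx,
        U^t* *m A *m U = castmx (en, en) (\mxdiag_(i < k) B i)
      & exists (i : 'I_k) (em : p i = m), castmx (em, em) (B i) = J].

End Definitions.

Arguments J2 {R}.

(* Main.v *)
Require Import Defs.
From mathcomp Require Import all_boot all_order all_algebra.
From mathcomp Require Import complex.
From mathcomp Require Import boolp classical_sets reals trigo.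
From mathcomp Require Import ring lra zify.
Import Order.TTheory GRing.Theory Num.Theory.
Local Open Scope ring_scope.

Set Implicit Arguments.
Unset Strict Implicit.
Unset Printing Implicit Defensive.

Local Open Scope sesquilinear_scope.

(** Let A be a partial isometry of rank 3. Choosing orthonormal coordinates on the
    orthogonal complement of ker A writes A = S W with S^H S = 1 and W W^H = 1, where
    ^H denotes the conjugate transpose. Everything is governed by the 3x3
    compression C = W S. The defect 1 means that 0 is a simple eigenvalue of C, so C
    can be put in the form [[0, v], [0, D]] with D an invertible 2x2 matrix.

    The curve contains the circle of center a and radius r exactly when, for every
    unit complex number w, both r and -r are eigenvalues of Re (w (A - a)). With t
    the conjugate of w and s = t^2, this implies that m = a + 2 r t + conj(a) s is an
    eigenvalue of A + s A^H. For m <> 0 a kernel vector is transported by W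
    ([pencil_compression]), so that (m - s C^H) (m - C) - s is singular. The
    product of m and of its determinant is a polynomial in t vanishing on the unit
    circle, hence identically.

    If a <> 0, the coefficients of degree 0 and 1 make a a double eigenvalue of D,
    and the coefficient of degree 2 then cannot vanish unless r = 0
    ([pencil_det_nonzero_center]). If a = 0, the lowest coefficient gives r = 1/2,
    and the next one gives v adj(D^H D) v^H = 0, i.e. v = 0
    ([pencil_det_zero_center], [gram_compression_eq0]). Then ker C is also the kernel
    of C^H, and a unit vector f in ker A^perp corresponding to it spans with A f a
    reducing subspace on which A is J2. Conversely, such a subspace carries
    eigenvectors of Re (w A) for the eigenvalues 1/2 and -1/2 ([J2_pair_curve]).

    Finally, if the numerical range were a disk, its boundary would be a circle
    contained in the curve ([disk_range_curve]), so the disk would be centered at 0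
    with radius 1/2; but an eigenvector of C for a nonzero eigenvalue v produces a
    point of modulus (1 + |v|)/2 in the range ([defect1_range_point]). *)

(** * Vanishing of the compressed pencil *)

Section PolynomialFunctions.
Variable K : fieldType.

(** Being a polynomial function; the closure lemmas below let the vanishing
    argument be applied to explicit formulas. *)
Definition polyfun (f : K -> K) : Prop := exists p : {poly K}, forall t, f t = p.[t].

Lemma polyfun_const c : polyfun (fun=> c).
Proof. by exists c%:P => t; rewrite hornerC. Qed.

Lemma polyfun_id : polyfun id.
Proof. by exists 'X => t; rewrite hornerX. Qed.

Lemma polyfunD f g : polyfun f -> polyfun g -> polyfun (fun t => f t + g t).
Proof. by move=> [p fp] [q gq]; exists (p + q) => t; rewrite hornerD fp gq. Qed.

Lemma polyfunN f : polyfun f -> polyfun (fun t => - f t).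
Proof. by move=> [p fp]; exists (- p) => t; rewrite hornerN fp. Qed.

Lemma polyfunM f g : polyfun f -> polyfun g -> polyfun (fun t => f t * g t).
Proof. by move=> [p fp] [q gq]; exists (p * q) => t; rewrite hornerM fp gq. Qed.

Lemma polyfunX f n : polyfun f -> polyfun (fun t => f t ^+ n).
Proof. by move=> [p fp]; exists (p ^+ n) => t; rewrite horner_exp fp. Qed.

(** A polynomial function with infinitely many zeros vanishes identically. *)
Lemma polyfun_eq0 f (z : nat -> K) : polyfun f -> injective z ->
  (forall k, f (z k) = 0) -> forall t, f t = 0.
Proof.
move=> [p fp] zI fz t; rewrite fp; suff -> : p = 0 by rewrite horner0.
apply/eqP; apply: contraT => p0.
have /(max_poly_roots p0) : all (root p) [seq z k | k <- iota 0 (size p)].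
  by apply/allP => _ /mapP[k _ ->]; apply/rootP; rewrite -fp fz.
by rewrite map_inj_uniq ?iota_uniq // size_map size_iota ltnn => /(_ isT).
Qed.

End PolynomialFunctions.

Ltac polyfun_tac :=
  repeat first [ apply: polyfun_const | apply: polyfun_id | apply: polyfunD
               | apply: polyfunN | apply: polyfunM | apply: polyfunX ].

Section PencilDeterminant.
(* The unprimed letters are the entries of C = [[0, x, y], [0, b, z], [0, w, c]],
   the primed ones those of its adjoint, here independent of the former. *)
Variable K : fieldType.
Variables x y b z w c x' y' b' z' w' c' : K.

(** The entries of the lower right 2x2 block of C^H C. *)
Definition gram11 := x' * x + b' * b + w' * w.
Definition gram12 := x' * y + b' * z + w' * c.
Definition gram21 := y' * x + z' * b + c' * w.
Definition gram22 := y' * y + z' * z + c' * c.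

(** The determinant of (m - s C^H) (m - C) - s, expanded along the first row and
    the first column; see [det_compressed_pencil]. *)
Definition pencil_det (m s : K) : K :=
  let k11 := m ^+ 2 - m * b - s * m * b' + s * gram11 - s in
  let k12 := - (m * z) - s * m * w' + s * gram12 in
  let k21 := - (m * w) - s * m * z' + s * gram21 in
  let k22 := m ^+ 2 - m * c - s * m * c' + s * gram22 - s in
  (m ^+ 2 - s) * (k11 * k22 - k12 * k21)
  - s * m ^+ 2 * (x * x' * k22 - x * y' * k12 - y * x' * k21 + y * y' * k11).

(** The characteristic polynomial of the 2x2 corner D = [[b, z], [w, c]] of C. *)
Definition corner_char (m : K) : K := (m - b) * (m - c) - z * w.

(** What is left of [pencil_det] from degree 2 in s on. *)
Definition pencil_det_tail (m s : K) : K :=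
  let h11 := gram11 - m * b' - 1 in
  let h12 := gram12 - m * w' in
  let h21 := gram21 - m * z' in
  let h22 := gram22 - m * c' - 1 in
  (m ^+ 2 - s) * (h11 * h22 - h12 * h21)
  - m * ((m - c) * h11 + z * h21 + w * h12 + (m - b) * h22)
  - m ^+ 2 * (x * x' * h22 - x * y' * h12 - y * x' * h21 + y * y' * h11).

(** The decisive fact: in degree 0 and 1 in s, [pencil_det] involves only the
    characteristic polynomial of D, its derivative and the trace of D^H. *)
Lemma pencil_det_expand m s : pencil_det m s = m ^+ 4 * corner_char m
  - s * (m ^+ 3 * (b' + c') * corner_char m + m ^+ 3 * (2 * m - b - c)
         + m ^+ 2 * corner_char m)
  + s ^+ 2 * pencil_det_tail m s.
Proof.
by rewrite /pencil_det /pencil_det_tail /corner_char /gram11 /gram12 /gram21 /gram22; ring.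
Qed.

Section Circle.
Variable t : nat -> K.
Hypotheses (t_inj : injective t) (t_neq0 : forall k, t k != 0).
Hypothesis two_neq0 : (2 : K) != 0.

(** A nonzero center a is impossible. With s = t^2 and m = a + 2 r t + a' t^2, the
    determinant is a polynomial in t, and vanishing in degree 0, 1 and 2 is
    contradictory. *)
Lemma pencil_det_nonzero_center (a a' r : K) : a != 0 -> r != 0 ->
  ~ forall k, let m := a + 2 * r * t k + a' * t k ^+ 2 in
      m != 0 -> pencil_det m (t k ^+ 2) = 0.
Proof.
move=> a0 r0 kd.
pose u s := 2 * r + a' * s; pose m s := a + s * u s.
(* The factor m removes the exception m = 0. *)
have kd' k : m (t k) * pencil_det (m (t k)) (t k ^+ 2) = 0.
  have [->|m0] := eqVneq (m (t k)) 0; first by rewrite mul0r.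
  rewrite [m _](_ : _ = a + 2 * r * t k + a' * t k ^+ 2) in m0 *.
    by rewrite kd // mulr0.
  by rewrite /m /u; ring.
have m0E : m 0 = a by rewrite /m mul0r addr0.
(* The polynomial is m times the determinant. Its value at 0 shows that a is an
   eigenvalue of the corner ... *)
have H0 : corner_char a = 0.
  pose f s := m s * pencil_det (m s) (s ^+ 2).
  have fpol : polyfun f by rewrite /f /pencil_det /m /u; polyfun_tac.
  have /eqP := polyfun_eq0 fpol t_inj kd' 0.
  rewrite [X in X == _](_ : _ = a ^+ 5 * corner_char a); last first.
    by rewrite /f m0E pencil_det_expand; ring.
  by rewrite mulf_eq0 expf_eq0 /= (negPf a0) => /eqP.
have chiE s : corner_char (m s) = s * (u s * (m s + a - b - c)).
  by rewrite -[LHS]subr0 -H0 /corner_char /m; ring.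
(* ... the coefficient of degree 1 that it is a double one ... *)
have H1 : b + c = 2 * a.
  pose f s := m s * (m s ^+ 4 * (u s * (m s + a - b - c))
    - s * (m s ^+ 3 * (b' + c') * corner_char (m s) + m s ^+ 3 * (2 * m s - b - c)
           + m s ^+ 2 * corner_char (m s)) + s ^+ 3 * pencil_det_tail (m s) (s ^+ 2)).
  have fpol : polyfun f by rewrite /f /pencil_det_tail /corner_char /m /u; polyfun_tac.
  have ft k : f (t k) = 0.
    apply: (mulfI (t_neq0 k)); rewrite mulr0 -[RHS](kd' k) pencil_det_expand /f chiE.
    by ring.
  have /eqP := polyfun_eq0 fpol t_inj ft 0.
  rewrite [X in X == _](_ : _ = 2 * r * a ^+ 5 * (2 * a - (b + c))).
    rewrite mulf_eq0 !mulf_eq0 /= (negPf a0) (negPf r0) (negPf two_neq0) /=.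
    by rewrite subr_eq0 => /eqP.
  by rewrite /f m0E /u H0; ring.
have {}chiE s : corner_char (m s) = s ^+ 2 * u s ^+ 2.
  by rewrite chiE -addrA -opprD -addrA H1 /m; ring.
(* ... and the coefficient of degree 2 is then 4 r^2 a^5, which is not 0. *)
pose f s := m s * (m s ^+ 4 * u s ^+ 2
    - (m s ^+ 3 * (b' + c') * corner_char (m s) + m s ^+ 3 * (2 * (m s - a))
           + m s ^+ 2 * corner_char (m s)) + s ^+ 2 * pencil_det_tail (m s) (s ^+ 2)).
have fpol : polyfun f by rewrite /f /pencil_det_tail /corner_char /m /u; polyfun_tac.
have ft k : f (t k) = 0.
  apply: (mulfI (t_neq0 k)); apply: (mulfI (t_neq0 k)); rewrite !mulr0.
  rewrite -[RHS](kd' k) pencil_det_expand /f chiE.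
  rewrite (_ : 2 * m (t k) - b - c = 2 * (m (t k) - a)); last first.
    by rewrite -addrA -opprD H1; ring.
  by ring.
have /eqP := polyfun_eq0 fpol t_inj ft 0.
rewrite [X in X == _](_ : _ = 2 ^+ 2 * r ^+ 2 * a ^+ 5).
  by rewrite !mulf_eq0 /= (negPf a0) (negPf r0) (negPf two_neq0).
by rewrite /f chiE m0E /u; ring.
Qed.

(** For the center 0, here with r twice the radius, the vanishing of the
    determinant forces r^2 = 1, and then v adj(D^H D) v^H = 0 where v = (x, y). *)
Lemma pencil_det_zero_center (r : K) : r != 0 -> b * c - z * w != 0 ->
  (forall k, pencil_det (r * t k) (t k ^+ 2) = 0) ->
  r ^+ 2 = 1 /\
  x * x' * (y' * y + z' * z + c' * c) - x * y' * (x' * y + b' * z + w' * c)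
  - y * x' * (y' * x + z' * b + c' * w) + y * y' * (x' * x + b' * b + w' * w) = 0.
Proof.
move=> r0 d0 kd.
pose n11 s := (r ^+ 2 - 1) * s - r * b - r * s ^+ 2 * b' + s * gram11.
pose n12 s := - (r * z) - r * s ^+ 2 * w' + s * gram12.
pose n21 s := - (r * w) - r * s ^+ 2 * z' + s * gram21.
pose n22 s := (r ^+ 2 - 1) * s - r * c - r * s ^+ 2 * c' + s * gram22.
pose v s := x * x' * n22 s - x * y' * n12 s - y * x' * n21 s + y * y' * n11 s.
have fE s : pencil_det (r * s) (s ^+ 2) = s ^+ 4 *
  ((r ^+ 2 - 1) * (n11 s * n22 s - n12 s * n21 s) - r ^+ 2 * s * v s).
  by rewrite /pencil_det /v /n11 /n12 /n21 /n22; ring.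
have H s : (r ^+ 2 - 1) * (n11 s * n22 s - n12 s * n21 s) - r ^+ 2 * s * v s = 0.
  move: s; apply: (polyfun_eq0 _ t_inj) => [|k].
    by rewrite /v /n11 /n12 /n21 /n22; polyfun_tac.
  by apply: (mulfI (expf_neq0 4 (t_neq0 k))); rewrite -fE kd mulr0.
have r1 : r ^+ 2 = 1.
  apply/eqP; have /eqP := H 0.
  rewrite [X in X == _](_ : _ = r ^+ 2 * (b * c - z * w) * (r ^+ 2 - 1)).
    by rewrite !mulf_eq0 /= (negPf r0) (negPf d0) /= subr_eq0.
  by rewrite /n11 /n12 /n21 /n22; ring.
split=> //.
have V s : v s = 0.
  move: s; apply: (polyfun_eq0 _ t_inj) => [|k].
    by rewrite /v /n11 /n12 /n21 /n22; polyfun_tac.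
  have /eqP := H (t k); rewrite r1 subrr mul0r sub0r oppr_eq0 mul1r mulf_eq0.
  by rewrite (negPf (t_neq0 k)) /= => /eqP.
(* v is a quadratic polynomial whose linear coefficient is the wanted form. *)
have /eqP : v 1 - v (-1) = 0 by rewrite !V subrr.
rewrite [X in X == _](_ : _ = 2 * (x * x' * gram22 - x * y' * gram12
                                   - y * x' * gram21 + y * y' * gram11)).
  by rewrite mulf_eq0 (negPf two_neq0) /= => /eqP.
by rewrite /v /n11 /n12 /n21 /n22 r1; ring.
Qed.

End Circle.
End PencilDeterminant.

(** * Adjoints and compression of a pencil *)

Section Adjoint.
Variable K : numClosedFieldType.

Lemma addmxE m n (A B : 'M[K]_(m, n)) i j : (A + B) i j = A i j + B i j.
Proof. exact: mxE. Qed.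

Lemma scalemxE m n a (A : 'M[K]_(m, n)) i j : (a *: A) i j = a * A i j.
Proof. exact: mxE. Qed.

Lemma oppmxE m n (A : 'M[K]_(m, n)) i j : (- A) i j = - A i j.
Proof. exact: mxE. Qed.

Lemma adjmxM m n p (A : 'M[K]_(m, n)) (B : 'M_(n, p)) :
  (A *m B)^t* = B^t* *m A^t*.
Proof. by rewrite trmx_mul map_mxM. Qed.

Lemma adjmxD m n (A B : 'M[K]_(m, n)) : (A + B)^t* = A^t* + B^t*.
Proof. by rewrite linearD map_mxD. Qed.

Lemma adjmxB m n (A B : 'M[K]_(m, n)) : (A - B)^t* = A^t* - B^t*.
Proof. by rewrite linearB map_mxB. Qed.

Lemma adjmxZ m n a (A : 'M[K]_(m, n)) : (a *: A)^t* = Num.conj a *: A^t*.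
Proof. by rewrite linearZ map_mxZ. Qed.

Lemma adjmx_scalar n a : (a%:M : 'M[K]_n)^t* = (Num.conj a)%:M.
Proof. by rewrite tr_scalar_mx map_scalar_mx. Qed.

Lemma adjmx1 n : (1%:M : 'M[K]_n)^t* = 1%:M.
Proof. by rewrite adjmx_scalar rmorph1. Qed.

Lemma gram_ge0 n (x : 'cV[K]_n) : 0 <= (x^t* *m x) 0 0.
Proof.
rewrite mxE sumr_ge0 // => i _; rewrite !mxE mulrC; exact: mul_conjC_ge0.
Qed.

Lemma gram_eq0 n (x : 'cV[K]_n) : (x^t* *m x) 0 0 = 0 -> x = 0.
Proof.
rewrite mxE => /eqP; rewrite psumr_eq0 => [/allP H|i _]; last first.
  by rewrite !mxE mulrC; exact: mul_conjC_ge0.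
apply/colP => i; have := H i (mem_index_enum i).
by rewrite !mxE mulrC mul_conjC_eq0 => /eqP.
Qed.

(** Polarization. *)
Lemma quadratic_form_eq0 n (G : 'M[K]_n) :
  (forall x : 'cV_n, (x^t* *m G *m x) 0 0 = 0) -> G = 0.
Proof.
move=> H.
have P (x y : 'cV_n) c :
    Num.conj c * (y^t* *m G *m x) 0 0 + c * (x^t* *m G *m y) 0 0 = 0.
  have := H (x + c *: y); rewrite adjmxD adjmxZ !(mulmxDl, mulmxDr).
  rewrite -?(scalemxAl, scalemxAr) !addrA !(addmxE, scalemxE).
  by rewrite !H !mulr0 add0r addr0 addrC.
have Q (x y : 'cV_n) : (x^t* *m G *m y) 0 0 = 0.
  have := P x y 1; have := P x y 'i; rewrite rmorph1 !mul1r conjCi mulNr.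
  rewrite addrC => /eqP; rewrite subr_eq0 => /eqP/(mulfI (neq0Ci _)) -> /eqP.
  by rewrite -mulr2n mulrn_eq0 /= => /eqP.
apply/matrixP => i j; have := Q (delta_mx i 0) (delta_mx j 0).
by rewrite trmx_delta map_delta_mx -rowE -colE !mxE.
Qed.

Lemma isometry_gram m n (S : 'M[K]_(n, m)) :
  (forall y : 'cV_m, ((S *m y)^t* *m (S *m y)) 0 0 = (y^t* *m y) 0 0) ->
  S^t* *m S = 1%:M.
Proof.
move=> H; apply/eqP; rewrite -subr_eq0; apply/eqP/quadratic_form_eq0 => x.
rewrite mulmxBr mulmxBl mulmx1 mxE [X in _ + X]mxE -H adjmxM.
by rewrite !mulmxA subrr.
Qed.

Lemma det0_colP n (M : 'M[K]_n) :
  reflect (exists2 x : 'cV_n, x != 0 & M *m x = 0) (\det M == 0).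
Proof.
rewrite -det_tr; apply: (iffP det0P) => -[x x0 Mx].
  by exists x^T; rewrite ?trmx_eq0 // -[M]trmxK -trmx_mul Mx trmx0.
by exists x^T; rewrite ?trmx_eq0 // -trmx_mul Mx trmx0.
Qed.

End Adjoint.

Section Factorization.
Variables (K : numClosedFieldType) (n : nat).
Variables (k : nat) (S : 'M[K]_(n, k)) (W : 'M[K]_(k, n)).
Hypotheses (SS : S^t* *m S = 1%:M) (WW : W *m W^t* = 1%:M).

(** The kernel of A + s A^H - m for A = S W is carried by W into the kernel of a
    matrix of size k depending on the compression W S only. *)
Lemma pencil_compression (m s : K) : m != 0 -> s != 0 ->
  \det (S *m W + s *: (S *m W)^t* - m%:M) = 0 ->
  \det ((m%:M - s *: (W *m S)^t*) *m (m%:M - W *m S) - s%:M) = 0.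
Proof.
move=> m0 s0 /eqP/det0_colP[x x0 Ax]; apply/eqP/det0_colP.
have {}Ax : S *m (W *m x) + s *: (W^t* *m (S^t* *m x)) = m *: x.
  move: Ax; rewrite mulmxBl mulmxDl mul_scalar_mx adjmxM -scalemxAl !mulmxA.
  by move/eqP; rewrite subr_eq0 => /eqP.
set p := W *m x in Ax; set q := S^t* *m x in Ax.
have Ep : (m%:M - W *m S) *m p = s *: q.
  rewrite mulmxBl mul_scalar_mx {1}/p scalemxAr -Ax mulmxDr -scalemxAr !mulmxA.
  by rewrite WW mul1mx addrAC subrr add0r.
have Eq : (m%:M - s *: (W *m S)^t*) *m q = p.
  rewrite mulmxBl mul_scalar_mx {1}/q scalemxAr -Ax mulmxDr !mulmxA SS mul1mx.
  by rewrite adjmxM -!(scalemxAl, scalemxAr) !mulmxA addrK.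
exists p; last by rewrite mulmxBl -mulmxA Ep -scalemxAr Eq mul_scalar_mx subrr.
apply: contraNneq x0 => p0; move/esym/eqP: Ep; rewrite p0 mulmx0 scaler_eq0.
rewrite (negPf s0) /= => /eqP q0; move/esym/eqP: Ax.
by rewrite p0 q0 !mulmx0 scaler0 addr0 scaler_eq0 (negPf m0).
Qed.

End Factorization.

Section Gram3.
Variable K : numClosedFieldType.
Implicit Type C : 'M[K]_3.
Local Notation "M @[ i , j ]" := (M (inord i : 'I_3) (inord j : 'I_3))
  (at level 2, format "M @[ i ,  j ]").

Lemma det3 (R : comNzRingType) (C : 'M[R]_3) : \det C =
  C@[0,0] * (C@[1,1] * C@[2,2] - C@[1,2] * C@[2,1])
  - C@[0,1] * (C@[1,0] * C@[2,2] - C@[1,2] * C@[2,0])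
  + C@[0,2] * (C@[1,0] * C@[2,1] - C@[1,1] * C@[2,0]).
Proof.
pose f i j := C@[i,j].
have Cf i j : C i j = f i j by rewrite /f !inord_val.
rewrite (expand_det_row _ ord0) !big_ord_recl big_ord0 /cofactor.
rewrite !(expand_det_row _ ord0) !big_ord_recl !big_ord0 /cofactor !det_mx11.
rewrite !mxE !Cf /= /bump /=.
by rewrite !inordK // !(addn0, add0n, add1n); ring.
Qed.

(** The entries of [C] are read off as in the section on [pencil_det], with the
    primed letters the complex conjugates. *)
Lemma det_compressed_pencil C (m s : K) : (forall i, C i 0 = 0) ->
  \det ((m%:M - s *: C^t*) *m (m%:M - C) - s%:M) =
  pencil_det C@[0,1] C@[0,2] C@[1,1] C@[1,2] C@[2,1] C@[2,2]
    (Num.conj C@[0,1]) (Num.conj C@[0,2]) (Num.conj C@[1,1])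
    (Num.conj C@[1,2]) (Num.conj C@[2,1]) (Num.conj C@[2,2]) m s.
Proof.
move=> C0.
pose f i j := C@[i,j].
have Cf i j : C i j = f i j by rewrite /f !inord_val.
have f0 i : f i 0%N = 0.
  rewrite /f -[RHS](C0 (inord i)); congr (C _ _).
  by apply: val_inj; rewrite /= inordK.
have inE i : (i < 3)%N -> inord i = i :> nat := @inordK 2 i.
rewrite det3 !mxE !big_ord_recl !big_ord0 !mxE !Cf -!(inj_eq val_inj) /=.
rewrite /bump /= !inE // !(addn0, add0n, add1n) !f0 !conjC0 ?mulr1n ?mulr0n.
rewrite /pencil_det /gram11 /gram12 /gram21 /gram22 -!/(f _ _).
by ring.
Qed.
End Gram3.

(** * Rank factorization and the defect *)

(** Sylvester's identity. *)
Lemma char_poly_mulC (K : comNzRingType) n k (S : 'M[K]_(n, k)) (W : 'M[K]_(k, n)) :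
  'X^k * char_poly (S *m W) = 'X^n * char_poly (W *m S).
Proof.
rewrite /char_poly /char_poly_mx !map_mxM.
set s := map_mx _ S; set w := map_mx _ W.
(* Eliminate either off-diagonal block of M. *)
pose M := block_mx 'X%:M s w 1%:M.
have E1 : \det M = \det ('X%:M - s *m w).
  have : M *m block_mx 1%:M 0 (- w) 1%:M = block_mx ('X%:M - s *m w) s 0 1%:M.
    rewrite mulmx_block !mulmx1 !mul1mx !mulmx0 !add0r mulmxN.
    by rewrite subrr.
  move=> /(congr1 determinant); rewrite det_mulmx det_lblock det_ublock !det1.
  by rewrite !mulr1.
have : M *m block_mx 1%:M (- s) 0 'X%:M = block_mx 'X%:M 0 w ('X%:M - w *m s).
  rewrite mulmx_block !mulmx1 !mul1mx !mulmx0 !addr0 !mulmxN.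
  by rewrite mul_mx_scalar mul_scalar_mx addNr addrC.
move=> /(congr1 determinant); rewrite det_mulmx det_lblock det_ublock !det1.
by rewrite !mul1r !det_scalar E1 mulrC.
Qed.

Section Factor.
Variables (R : realType).
Local Notation K := R[i].

(** The rows of W are an orthonormal basis of the orthogonal complement of ker A,
    and S is the isometry A W^H. *)
Lemma partial_isometry_factor n (A : 'M[K]_n) k :
  partial_isometry A -> \rank A = k ->
  exists (S : 'M[K]_(n, k)) (W : 'M[K]_(k, n)),
    [/\ A = S *m W, S^t* *m S = 1%:M & W *m W^t* = 1%:M].
Proof.
move=> piA <-; set W := schmidt (row_base A).
have WW : W *m W^t* = 1%:M by apply/unitarymxP/schmidt_unitarymx/rank_leq_col.
have WA : (W :=: A)%MS.
  by apply: eqmx_trans (eq_row_base A); apply: eqmx_schmidt_free; apply: row_base_free.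
have AE : A = A *m W^t* *m W.
  have /submxP[T AT] : (A <= W)%MS by rewrite WA.
  have -> : A *m W^t* = T by rewrite [X in X *m _]AT -mulmxA WW mulmx1.
  exact: AT.
have /submxP[T WE] : (W <= A)%MS by rewrite WA.
exists (A *m W^t*), W; split=> //.
apply: isometry_gram => y; rewrite -mulmxA.
have /(congr1 (fun z => z ^+ 2)) : vnorm (A *m (W^t* *m y)) = vnorm (W^t* *m y).
  apply: piA => z Az; rewrite /inner mulmxA -[z^t* *m _]trmxCK adjmxM !trmxCK.
  by rewrite WE -mulmxA Az mulmx0 trmx0 map_mx0 mul0mx mxE.
rewrite /vnorm !sqrtCK /inner => ->.
by rewrite adjmxM trmxCK -mulmxA (mulmxA W) WW mul1mx.
Qed.

(** Q^H is unitary and its first column is proportional to x. *)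
Lemma unitary_first_column k (x : 'cV[K]_k.+1) : x != 0 ->
  exists2 Q : 'M[K]_k.+1, Q *m Q^t* = 1%:M &
    exists2 c, c != 0 & x = c *: col 0 (Q^t*).
Proof.
move=> x0.
(* Only the first row matters: Gram-Schmidt completes a dependent family too. *)
set V : 'M[K]_k.+1 := \matrix_(i < k.+1) x^t*.
exists (schmidt V); first exact/unitarymxP/schmidt_unitarymx.
have := row_schmidt_sub V 0; rewrite (big_pred1 0); last first.
  by move=> i; rewrite /= leqn0.
rewrite genmxE rowK => /submxP[D /(congr1 (fun M => M^t*))].
rewrite trmxCK adjmxM (mx11_scalar D) adjmx_scalar mul_mx_scalar => xE.
have xE' : x = Num.conj (D 0 0) *: col 0 ((schmidt V)^t*).
  by rewrite {1}xE; congr (_ *: _); apply/matrixP => i j; rewrite !mxE.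
exists (Num.conj (D 0 0)) => //.
by apply: contraNneq x0 => c0; rewrite xE' c0 scale0r.
Qed.

(** A unitary change of the factors puts a kernel vector of the compression W S
    into first position. *)
Lemma partial_isometry_factor_ker n (A : 'M[K]_n) k (S : 'M[K]_(n, k.+1)) W :
  A = S *m W -> S^t* *m S = 1%:M -> W *m W^t* = 1%:M -> \det (W *m S) = 0 ->
  exists (S : 'M[K]_(n, k.+1)) (W : 'M[K]_(k.+1, n)),
    [/\ A = S *m W, S^t* *m S = 1%:M, W *m W^t* = 1%:M
      & forall i, (W *m S) i 0 = 0].
Proof.
move=> AE SS WW /eqP/det0_colP[x x0 Cx].
have [Q QQ [c c0 xE]] := unitary_first_column x0.
exists (S *m Q^t*), (Q *m W).
have QQ' : Q^t* *m Q = 1%:M by apply: mulmx1C.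
split.
- by rewrite -mulmxA (mulmxA _ Q) QQ' mul1mx.
- by rewrite adjmxM trmxCK -mulmxA (mulmxA _ S) SS mul1mx.
- by rewrite adjmxM -mulmxA (mulmxA W) WW mul1mx.
move=> i; have : col 0 (Q *m W *m (S *m Q^t*)) = 0.
  apply: (scalerI c0); rewrite scaler0.
  have -> : col 0 (Q *m W *m (S *m Q^t*)) = Q *m W *m S *m col 0 (Q^t*).
    by rewrite !colE !mulmxA.
  by rewrite scalemxAr -xE -(mulmxA Q) -mulmxA Cx mulmx0.
by move/colP/(_ i); rewrite !mxE.
Qed.

End Factor.

Section Defect.
Variables (R : realType).
Local Notation K := R[i].
Variables (n : nat) (A : 'M[K]_n) (S : 'M[K]_(n, 3)) (W : 'M[K]_(3, n)).
Hypotheses (AE : A = S *m W) (rA : \rank A = 3%N) (defA : defect A = 1%N).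

Lemma rank3_dim : (2 < n)%N.
Proof. by rewrite -rA rank_leq_row. Qed.

Lemma alg_mult_defect1 : alg_mult A 0 = (n - 2)%N.
Proof.
have n3 := rank3_dim.
move: defA; rewrite /defect /geom_mult /eigenspace (rmorph0 (@scalar_mx K n)) subr0.
rewrite mxrank_ker mxrank_tr rA => H.
by lia.
Qed.

Lemma det_compression0 : \det (W *m S) = 0.
Proof.
have n3 := rank3_dim.
have Ap0 : char_poly A != 0 by rewrite monic_neq0 ?char_poly_monic.
have : (n - 2 <= alg_mult A 0%R)%N by rewrite alg_mult_defect1.
rewrite /alg_mult mup_geq // subr0 => /dvdpP[q Aq].
have {Aq} CX : char_poly (W *m S) = q * 'X.
  apply: (mulfI (monic_neq0 (monicXn K n))); rewrite -char_poly_mulC -AE Aq.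
  have -> : 'X^n = 'X^(n - 2) * 'X^2 :> {poly K} by rewrite -exprD subnK // ltnW.
  by ring.
have := char_poly_det (W *m S); rewrite CX coefMX /= => /esym/eqP.
by rewrite mulf_eq0 signr_eq0 => /eqP.
Qed.

(** Defect 1 says that 0 is a simple eigenvalue of the compression. *)
Lemma det_compression_drsub : (forall i, (W *m S) i 0 = 0) ->
  (W *m S) (inord 1) (inord 1) * (W *m S) (inord 2) (inord 2)
  - (W *m S) (inord 1) (inord 2) * (W *m S) (inord 2) (inord 1) != 0.
Proof.
move=> C0; have n3 := rank3_dim.
have Ap0 : char_poly A != 0 by rewrite monic_neq0 ?char_poly_monic.
have := char_poly_mulC S W; rewrite -AE.
move: (W *m S) C0 => C C0 AC; apply/negP => /eqP D0.
pose q : {poly K} := 'X - (C (inord 1) (inord 1) + C (inord 2) (inord 2))%:P.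
have CX : char_poly C = 'X^2 * q.
  rewrite /char_poly /char_poly_mx det3 !mxE -!(inj_eq val_inj) /= !inordK //=.
  have C0' i : C i (inord 0) = 0.
    by rewrite -[RHS](C0 i); congr (C _ _); apply: val_inj; rewrite /= inordK.
  rewrite !C0' ?mulr1n ?mulr0n /q.
  set b := C _ _ in D0 *; set c := C (inord 2) (inord 2) in D0 *.
  set z := C _ _ in D0 *; set w := C _ _ in D0 *.
  have /(congr1 polyC) : z * w = b * c by apply/esym/eqP; rewrite -subr_eq0 D0.
  rewrite !polyCM polyCD => E.
  by ring: E.
have AX : char_poly A = 'X^(n - 1) * q.
  apply: (mulfI (monic_neq0 (monicXn K 3))); rewrite AC CX.
  have -> : 'X^n = 'X^(n - 1) * 'X :> {poly K}.
    by rewrite -exprSr; congr ('X^_); lia.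
  by ring.
have : (n - 1 <= alg_mult A 0%R)%N.
  by rewrite /alg_mult mup_geq // subr0 AX dvdp_mulIl.
by rewrite alg_mult_defect1; lia.
Qed.

End Defect.

(** * Circles and the Kippenhahn polynomial *)

Section Kippenhahn.
Local Open Scope complex_scope.
Variable R : realType.
Local Notation K := R[i].

Lemma conj_real (r : R) : Num.conj (r%:C : K) = r%:C.
Proof. exact: conjc_real. Qed.

Lemma expi_conjM (t : R) : expi t * Num.conj (expi t) = 1.
Proof.
rewrite /expi; apply/eqP; rewrite eq_complex /= mulrN opprK -!expr2 cos2Dsin2 eqxx /=.
by rewrite mulrN mulrC addNr.
Qed.

Lemma expi_neq0 (t : R) : expi t != 0.
Proof. by apply: contra_eq_neq (expi_conjM t) => ->; rewrite mul0r eq_sym oner_eq0. Qed.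

(** Infinitely many distinct points of the unit circle, each the conjugate of some
    [expi t]. *)
Definition circle_seq (k : nat) : K := Num.conj (expi (acos (k.+1%:R^-1 : R))).

Lemma circle_seq_inj : injective circle_seq.
Proof.
move=> j k /(congr1 (@complex.Re R)) /=.
have ran i : (i.+1%:R^-1 : R) \in `[-1, 1].
  rewrite in_itv /= (le_trans (y := 0)) ?oppr_le0 ?ler01 ?invr_ge0 //=.
  by rewrite invf_le1 ?ler1n ?ltr0n.
by rewrite !acosK // => /invr_inj /eqP; rewrite eqr_nat => /eqP[].
Qed.

Lemma circle_seq_neq0 k : circle_seq k != 0.
Proof. by rewrite conjC_eq0 expi_neq0. Qed.

Lemma kippenhahn_horner n (A : 'M[K]_n) t x :
  (kippenhahn_poly A t).[x] = \det (Re_mx (expi t *: A) - x%:M).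
Proof.
rewrite /kippenhahn_poly -horner_evalE -det_map_mx map_mxB; congr (\det (_ - _)).
  by rewrite -map_mx_comp; apply/matrixP => i j; rewrite !mxE /= horner_evalE hornerC.
by rewrite map_scalar_mx /= horner_evalE hornerX.
Qed.

(** Containment of a circle read off on the roots of the Kippenhahn polynomial. *)
Lemma curve_contains0P n (A : 'M[K]_n) (r : R) : 0 < r ->
  curve_contains0 A r <->
  forall t, \det (Re_mx (expi t *: A) - (r%:C)%:M) = 0 /\
            \det (Re_mx (expi t *: A) - (- r%:C)%:M) = 0.
Proof.
move=> r0.
have fact : 'X^2 - ((r ^+ 2)%:C)%:P = ('X - (r%:C)%:P) * ('X - (- r%:C)%:P) :> {poly K}.
  have -> : (r ^+ 2)%:C = r%:C ^+ 2 by exact: rmorphXn.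
  move: (r%:C) => z; rewrite polyCN polyC_exp.
  by ring.
have cop : coprimep ('X - (r%:C)%:P) ('X - (- r%:C)%:P : {poly K}).
  by rewrite coprimep_XsubC root_XsubC eqNr (inj_eq (@complexI R) r 0) gt_eqF.
split=> H t; have := H t;
  rewrite ?fact Gauss_dvdp // !dvdp_XsubCl !rootE !kippenhahn_horner.
  by move=> /andP[/eqP-> /eqP->].
by move=> [-> ->]; rewrite eqxx.
Qed.

(** Multiplying Re (w (A - a)) - r by 2 s with s the conjugate of the unit complex
    number w yields a pencil that is polynomial in s. *)
Lemma det_Re_pencil n (A : 'M[K]_n) (a : K) (r t : R) (s := Num.conj (expi t)) :
  \det (Re_mx (expi t *: (A - a%:M)) - (r%:C)%:M) = 0 ->
  \det (A + s ^+ 2 *: A^t* - (a + 2 * r%:C * s + Num.conj a * s ^+ 2)%:M) = 0.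
Proof.
move=> H.
have -> : A + s ^+ 2 *: A^t* - (a + 2 * r%:C * s + Num.conj a * s ^+ 2)%:M
   = (2 * s) *: (Re_mx (expi t *: (A - a%:M)) - (r%:C)%:M).
  rewrite /Re_mx adjmxZ adjmxB adjmx_scalar -/s.
  have E := expi_conjM t; rewrite -/s in E.
  apply/matrixP => i j; rewrite !mxE.
  case: (i == j); rewrite ?mulr0n ?mulr1n.
    set u := A i j; set v := Num.conj _.
    have := E; move: (expi t) => w Ew.
    have n2 : (2 : K) != 0 by rewrite pnatr_eq0.
    transitivity (w * s * (u - a) + s ^+ 2 * (v - Num.conj a) - 2 * s * r%:C).
      by rewrite Ew; ring.
    by field.
  set u := A i j; set v := Num.conj _.
  have := E; move: (expi t) => w Ew.
  transitivity (w * s * u + s ^+ 2 * v); first by rewrite Ew; ring.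
  by field.
by rewrite detZ H mulr0.
Qed.

(** f and g = A f span a subspace reducing A, on which A acts as J2 (the entry 1
    of J2 sends the second basis vector f to the first one g). *)
Definition J2_pair n (A : 'M[K]_n) (f g : 'cV[K]_n) : Prop :=
  [/\ A *m f = g, A *m g = 0, A^t* *m g = f & A^t* *m f = 0].

(** The vectors f + exp(i t) g and f - exp(i t) g are eigenvectors of
    Re (exp(i t) A) for the eigenvalues 1/2 and -1/2. *)
Lemma J2_pair_curve n (A : 'M[K]_n) f g :
  J2_pair A f g -> f != 0 -> curve_contains A 0 (1 / 2).
Proof.
move=> [Af Ag A'g A'f] f0; rewrite /curve_contains (rmorph0 (@scalar_mx K n)) subr0.
apply/curve_contains0P => [|t]; first by rewrite divr_gt0.
have E := expi_conjM t.
have key (e : K) : e ^+ 2 = 1 ->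
    \det (Re_mx (expi t *: A) - (e * (1 / 2)%:C)%:M) = 0.
  move=> e1; apply/eqP/det0_colP; exists (f + (e * expi t) *: g).
    apply: contraNneq f0 => fg; have := congr1 (mulmx A) fg.
    by rewrite mulmx0 mulmxDr -scalemxAr Ag scaler0 addr0 Af => g0; rewrite -A'g g0 mulmx0.
  rewrite /Re_mx adjmxZ mulmxBl mul_scalar_mx -scalemxAl mulmxDl -!scalemxAl.
  rewrite !mulmxDr -!scalemxAr Af Ag A'g A'f !(scaler0, addr0, add0r).
  rewrite rmorphM fmorphV rmorph1 (rmorph_nat (real_complex R) 2) mul1r.
  rewrite !scalerDr !scalerA.
  have -> : e * 2^-1 * (e * expi t) = 2^-1 * expi t by rewrite -[RHS]mul1r -e1; ring.
  have -> : 2^-1 * Num.conj (expi t) * (e * expi t) = e * 2^-1.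
    by rewrite -[RHS]mul1r -E; ring.
  by rewrite [X in X - _]addrC subrr.
split; first by have := key 1 (expr1n _ _); rewrite mul1r.
by have := key (-1) (etrans (sqrrN 1) (expr1n _ _)); rewrite mulN1r.
Qed.


End Kippenhahn.

(** * Splitting off a block J2 *)

Section Reducible.
Variable R : realType.
Local Notation K := R[i].

Lemma J2_pair_similar n (A U : 'M[K]_n) f g : U \is unitarymx ->
  J2_pair (U^t* *m A *m U) f g -> J2_pair A (U *m f) (U *m g).
Proof.
move=> /unitarymxP UU; have UU' : U^t* *m U = 1%:M by apply: mulmx1C.
have cancel B (h k : 'cV_n) : U^t* *m B *m U *m h = k -> B *m (U *m h) = U *m k.
  by move=> <-; rewrite !mulmxA UU mul1mx.
rewrite /J2_pair !adjmxM trmxCK => -[Af Ag A'g A'f]; split.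
- exact: cancel.
- by rewrite (cancel A g 0 Ag) mulmx0.
- by apply: cancel; rewrite -A'g !mulmxA.
- by rewrite (cancel _ f 0) ?mulmx0 // -[RHS]A'f !mulmxA.
Qed.

Lemma J2_pair_J2 m (B : 'M[K]_m) (em : m = 2%N) :
  castmx (em, em) B = J2 -> exists f g, J2_pair B f g /\ f != 0.
Proof.
subst m; rewrite castmx_id => ->.
exists (delta_mx 1 0), (delta_mx 0 0); split; last first.
  by apply/eqP => /matrixP/(_ 1 0); rewrite !mxE => /eqP; rewrite oner_eq0.
split; rewrite -colE; apply/colP => -[[|[|//]] i2]; rewrite !mxE /=;
  by rewrite ?conjC0 ?conjC1.
Qed.

(** The block column with h in position i and zero blocks elsewhere; [conform_mx]
    only transports h along i = j. *)
Definition mxcol_single k (p : 'I_k -> nat) i (h : 'cV[K]_(p i)) :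
    'cV[K]_(\sum_i p i) :=
  \mxcol_j (if i == j then conform_mx (0 : 'cV_(p j)) h else 0).

Lemma mxdiag_mxcol_single k (p : 'I_k -> nat) (B : forall i, 'M[K]_(p i))
    i (h : 'cV_(p i)) :
  \mxdiag_i B i *m mxcol_single h = mxcol_single (B i *m h).
Proof.
rewrite /mxcol_single mul_mxdiag_mxcol; apply: eq_mxcol => j.
by case: eqP => [<-|]; rewrite ?conform_mx_id ?mulmx0.
Qed.

Lemma mxcol_single0 k (p : 'I_k -> nat) i : mxcol_single (0 : 'cV[K]_(p i)) = 0.
Proof.
rewrite -[RHS](@mxcol0 _ _ p); apply: eq_mxcol => j.
by case: eqP => [<-|] //; rewrite conform_mx_id.
Qed.

Lemma mxcol_single_eq0 k (p : 'I_k -> nat) i (h : 'cV[K]_(p i)) :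
  mxcol_single h = 0 -> h = 0.
Proof.
move=> /(congr1 (fun M => submxcol M i)).
by rewrite mxcolK eqxx conform_mx_id submxcol0.
Qed.

Lemma adjmx_mxdiag k (p : 'I_k -> nat) (B : forall i, 'M[K]_(p i)) :
  (\mxdiag_i B i)^t* = \mxdiag_i (B i)^t*.
Proof.
rewrite tr_mxdiag; apply/matrixP => i j; rewrite !mxE.
case: eqP => E; last by rewrite !mxE conjC0.
by case: _ / E (tagnat.sig2 j) => l; rewrite !conform_mx_id !mxE.
Qed.

Lemma reducible_J2_pair n (A : 'M[K]_n) :
  unitarily_reducible_with A J2 -> exists f g, J2_pair A f g /\ f != 0.
Proof.
move=> [k [p [B [en [U [_ _ Uu UAU [i [em Bi]]]]]]]].
subst n; rewrite castmx_id in UAU.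
have [f [g [[Bf Bg B'g B'f] f0]]] := J2_pair_J2 Bi.
exists (U *m mxcol_single f), (U *m mxcol_single g); split; last first.
  apply: contraNneq f0 => /(congr1 (mulmx (U^t*))).
  rewrite mulmxA (mulmx1C (unitarymxP Uu)) mul1mx mulmx0 => H.
  by rewrite (mxcol_single_eq0 H).
apply: J2_pair_similar => //; rewrite UAU.
split; rewrite ?adjmx_mxdiag mxdiag_mxcol_single.
- by rewrite Bf.
- by rewrite Bg mxcol_single0.
- by rewrite B'g.
- by rewrite B'f mxcol_single0.
Qed.

End Reducible.

Section Split.
Variable R : realType.
Local Notation K := R[i].

Lemma orthonormal_complement m n (Z : 'M[K]_(n, m)) : Z^t* *m Z = 1%:M ->
  exists l (Y : 'M[K]_(l, n)), [/\ (m + l)%N = n, Y *m Y^t* = 1%:M & Y *m Z = 0].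
Proof.
move=> ZZ; have rZ : \rank Z = m.
  rewrite -mxrank_tr -(mxrank_map (@Num.conj K)); apply: mxrank_unitary.
  by apply/unitarymxP; rewrite trmxCK.
exists (\rank (kermx Z)), (schmidt (row_base (kermx Z))); split.
- by rewrite mxrank_ker rZ subnKC // -rZ rank_leq_row.
- exact/unitarymxP/schmidt_unitarymx/rank_leq_col.
- apply/sub_kermxP; rewrite eqmx_schmidt_free ?row_base_free //.
  by rewrite eq_row_base.
Qed.

(** The block sizes p and m, in this order. *)
Definition two_blocks (p m : nat) (i : 'I_2) : nat :=
  if nat_of_ord i is 0%N then p else m.

(** The family of the two diagonal blocks B and D. *)
Definition two_diag p m (B : 'M[K]_p) (D : 'M[K]_m) (i : 'I_2) : 'M[K]_(two_blocks p m i) :=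
  match nat_of_ord i as k return 'M[K]_(if k is 0%N then p else m) with
  | 0%N => B | _ => D end.

Lemma two_blocks_sum p m : (\sum_i two_blocks p m i = p + m)%N.
Proof. by rewrite !big_ord_recl big_ord0 addn0. Qed.

(** A block of size 0 can be dropped from a block diagonal matrix. *)
Lemma castmx_block_empty m s q (es : s = 0%N) (em : (m + s)%N = q) (eq : m = q)
    (D : 'M[K]_m) (E : 'M[K]_s) :
  castmx (em, em) (block_mx D 0 0 E) = castmx (eq, eq) D.
Proof.
subst s q; rewrite castmx_id; apply/matrixP => i j; rewrite castmxE.
case: (split_ordP i) => [i1 ->|[] //]; case: (split_ordP j) => [j1 ->|[] //].
by rewrite block_mxEul; congr (D _ _); apply: val_inj.
Qed.

Lemma mxdiag_two p m (B : 'M[K]_p) (D : 'M[K]_m) :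
  castmx (two_blocks_sum p m, two_blocks_sum p m) (\mxdiag_i two_diag B D i) =
  block_mx B 0 0 D.
Proof.
have s0 : (\sum_(i < 0) two_blocks p m (lift ord0 (lift ord0 i)) = 0)%N.
  by rewrite big_ord0.
have eq : m = (\sum_(i < 1) two_blocks p m (lift ord0 i))%N.
  by rewrite big_ord_recl big_ord0 addn0.
rewrite !mxdiag_recl !castmx_comp (castmx_block_empty s0 _ eq).
have gen q (eq' : m = q) (e : (p + q = p + m)%N) :
    castmx (e, e) (block_mx B 0 0 (castmx (eq', eq') D)) = block_mx B 0 0 D.
  by subst q; rewrite !castmx_id.
exact: gen.
Qed.

Lemma J2_pair_reducible n (A : 'M[K]_n) (f g : 'cV[K]_n) :
  J2_pair A f g -> (2 < n)%N -> f^t* *m f = 1%:M -> g^t* *m g = 1%:M ->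
  f^t* *m g = 0 -> unitarily_reducible_with A J2.
Proof.
move=> [Af Ag A'g A'f] n2 ff gg fg.
have gf : g^t* *m f = 0 by rewrite -[LHS]trmxCK adjmxM trmxCK fg trmx0 map_mx0.
(* The order g, f of the columns is forced by the position of the entry 1 of J2. *)
pose Z : 'M[K]_(n, 1 + 1) := row_mx g f.
have ZZ : Z^t* *m Z = 1%:M.
  rewrite /Z tr_row_mx map_col_mx mul_col_row ff gg gf fg.
  by rewrite -scalar_mx_block.
have J2E : J2 = block_mx 0 1%:M 0 0 :> 'M[K]_(1 + 1).
  apply/matrixP => i j.
  case: (split_ordP i) => i1 ->; case: (split_ordP j) => j1 ->;
    rewrite ?(block_mxEul, block_mxEur, block_mxEdl, block_mxEdr) !mxE;
    by rewrite (ord1 i1) (ord1 j1).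
have AZ : A *m Z = Z *m (J2 : 'M_(1 + 1)).
  rewrite J2E /Z mul_mx_row mul_row_block Af Ag.
  by rewrite !(mulmx0, mulmx1, addr0).
have A'Z : A^t* *m Z = Z *m (J2 : 'M_(1 + 1))^t*.
  rewrite J2E /Z tr_block_mx map_block_mx mul_mx_row mul_row_block A'f A'g.
  by rewrite !trmx0 !map_mx0 adjmx1 !(mulmx0, mulmx1, addr0, add0r).
have [m [Y [nE YY YZ]]] := orthonormal_complement ZZ.
have m0 : (0 < m)%N by rewrite -nE in n2.
have ZY : Z^t* *m Y^t* = 0 by rewrite -adjmxM YZ trmx0 map_mx0.
have ZAY : Z^t* *m A *m Y^t* = 0.
  have -> : Z^t* *m A = (J2 : 'M_(1 + 1)) *m Z^t*.
    by rewrite -[LHS]trmxCK adjmxM trmxCK A'Z adjmxM trmxCK.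
  by rewrite -mulmxA ZY mulmx0.
move: Z Y {nE}(esym nE) {n2} ZZ AZ {A'Z} YY YZ ZY ZAY => Z Y nE.
subst n => ZZ AZ YY YZ ZY ZAY.
pose U : 'M_(2 + m) := row_mx Z (Y^t*).
have UE : U^t* = col_mx (Z^t*) Y by rewrite /U tr_row_mx map_col_mx trmxCK.
exists 2%N, (two_blocks 2 m), (two_diag J2 (Y *m A *m Y^t*)), (two_blocks_sum 2 m), U.
split=> //.
- by move=> [[|i] ?].
- apply/unitarymxP; apply: mulmx1C.
  by rewrite UE mul_col_row ZZ YZ ZY YY -scalar_mx_block.
- rewrite mxdiag_two UE mul_col_mx mul_col_row ZAY.
  by rewrite -!(mulmxA _ A) AZ !mulmxA ZZ YZ mul1mx mul0mx.
- by exists 0, erefl; rewrite castmx_id.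
Qed.
End Split.

(** * Circles contained in the curve *)

(** The form v adj(D^H D) v^H is the squared norm of v adj(D), and D is invertible. *)
Lemma gram_compression_eq0 (K : numClosedFieldType) (x y b z w c : K) :
  b * c - z * w != 0 ->
  x * Num.conj x * (Num.conj y * y + Num.conj z * z + Num.conj c * c)
  - x * Num.conj y * (Num.conj x * y + Num.conj b * z + Num.conj w * c)
  - y * Num.conj x * (Num.conj y * x + Num.conj z * b + Num.conj c * w)
  + y * Num.conj y * (Num.conj x * x + Num.conj b * b + Num.conj w * w) = 0 ->
  x = 0 /\ y = 0.
Proof.
move=> d0; set u := x * c - y * w; set v := y * b - x * z.
rewrite [X in X = 0](_ : _ = u * Num.conj u + v * Num.conj v); last first.
  by rewrite /u /v !rmorphB !rmorphM /=; ring.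
move=> /eqP; rewrite paddr_eq0 ?mul_conjC_ge0 // !mul_conjC_eq0 => /andP[/eqP u0 /eqP v0].
have xd : x * (b * c - z * w) = 0.
  have -> : x * (b * c - z * w) = b * u + w * v by rewrite /u /v; ring.
  by rewrite u0 v0 !mulr0 addr0.
have yd : y * (b * c - z * w) = 0.
  have -> : y * (b * c - z * w) = z * u + c * v by rewrite /u /v; ring.
  by rewrite u0 v0 !mulr0 addr0.
by split; apply/eqP; [move/eqP: xd | move/eqP: yd]; rewrite mulf_eq0 (negPf d0) orbF.
Qed.

Section CircleStructure.
Local Open Scope complex_scope.
Variable R : realType.
Local Notation K := R[i].
Variables (n : nat) (A : 'M[K]_n).
Hypotheses (piA : partial_isometry A) (rA : \rank A = 3%N) (defA : defect A = 1%N).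

Lemma defect1_factor : exists (S : 'M[K]_(n, 3)) (W : 'M[K]_(3, n)),
  [/\ A = S *m W, S^t* *m S = 1%:M, W *m W^t* = 1%:M
    & forall i, (W *m S) i 0 = 0].
Proof.
have [S [W [AE SS WW]]] := partial_isometry_factor piA rA.
exact: (partial_isometry_factor_ker AE SS WW (det_compression0 AE rA defA)).
Qed.

(** If a circle is contained in the curve, then its center is 0 and its radius 1/2,
    and the compression C = W S has a zero first row besides its zero first
    column; then f = W^H e and g = S e, with e the first basis vector, form a
    J2 pair. *)
Lemma circle_structure a r : 0 < r -> curve_contains A a r ->
  [/\ a = 0, r = 1 / 2 & unitarily_reducible_with A J2].
Proof.
move=> r0 cc.
have [S [W [AE SS WW C0]]] := defect1_factor.
have := det_compression_drsub AE rA defA C0.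
have := det_compressed_pencil _ _ C0.
set x := (W *m S) (inord 0) (inord 1); set y := (W *m S) (inord 0) (inord 2).
set b := (W *m S) (inord 1) (inord 1); set z := (W *m S) (inord 1) (inord 2).
set w := (W *m S) (inord 2) (inord 1); set c := (W *m S) (inord 2) (inord 2).
move=> pdE D0.
have r0' : r%:C != 0 :> K by rewrite (inj_eq (@complexI R) r 0) gt_eqF.
have two0 : (2 : K) != 0 by rewrite pnatr_eq0.
have kd k (t := circle_seq R k) (m := a + 2 * r%:C * t + Num.conj a * t ^+ 2) :
    m != 0 -> pencil_det x y b z w c (Num.conj x) (Num.conj y) (Num.conj b)
      (Num.conj z) (Num.conj w) (Num.conj c) m (t ^+ 2) = 0.
  move=> m0; rewrite -pdE; apply: pencil_compression => //.
    by rewrite expf_neq0 // circle_seq_neq0.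
  rewrite -AE; apply: det_Re_pencil.
  by have [/(_ cc (acos (k.+1%:R^-1)))[]] := curve_contains0P (A - a%:M) r0.
have a0 : a = 0.
  apply/eqP; apply: contraT => a0.
  by case: (pencil_det_nonzero_center (@circle_seq_inj R) (@circle_seq_neq0 R)
              two0 a0 r0' kd).
subst a.
have [] := pencil_det_zero_center (@circle_seq_inj R) (@circle_seq_neq0 R) two0
  (mulf_neq0 two0 r0') D0 (x := x) (y := y) (x' := Num.conj x) (y' := Num.conj y)
  (b' := Num.conj b) (z' := Num.conj z) (w' := Num.conj w) (c' := Num.conj c).
  move=> k; have := kd k; cbv zeta; rewrite conjC0 mul0r addr0 add0r; apply.
  by rewrite !mulf_neq0 // circle_seq_neq0.
move=> r1 /(gram_compression_eq0 D0)[x0 y0].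
have rE : r = 1 / 2.
  have : (2 * r) ^+ 2 = 1.
    apply: (@complexI R); rewrite -[RHS]r1 rmorphXn rmorphM.
    by rewrite (rmorph_nat (real_complex R) 2).
  move/eqP; rewrite sqrf_eq1 => /orP[/eqP|/eqP] r2; lra.
split=> //.
pose e := delta_mx 0 0 : 'cV[K]_3.
have ee : e^t* *m e = 1%:M.
  rewrite /e trmx_delta map_delta_mx mul_delta_mx.
  by apply/matrixP => i j; rewrite !mxE (ord1 i) (ord1 j).
have Ce : W *m S *m e = 0 by rewrite -colE; apply/colP => i; rewrite !mxE -[RHS](C0 i) mxE.
have C'e : (W *m S)^t* *m e = 0.
  rewrite -colE; apply/colP => i; rewrite 2!mxE [RHS]mxE [_^T _ _]mxE.
  have -> : (W *m S) 0 i = 0; last by rewrite conjC0.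
  have i00 : inord 0 = 0 :> 'I_3 by apply: val_inj; rewrite /= inordK.
  case: i => [[|[|[|//]]] i3].
  - by rewrite -[RHS](C0 0); congr ((_ *m _) _ _); apply: val_inj.
  - by rewrite -[RHS]x0 /x i00; congr ((_ *m _) _ _); apply: val_inj; rewrite /= inordK.
  - by rewrite -[RHS]y0 /y i00; congr ((_ *m _) _ _); apply: val_inj; rewrite /= inordK.
apply: (@J2_pair_reducible _ _ _ (W^t* *m e) (S *m e)); last 4 first.
- exact: (rank3_dim rA).
- by rewrite adjmxM trmxCK -mulmxA (mulmxA W) WW mul1mx.
- by rewrite adjmxM -mulmxA (mulmxA _ S) SS mul1mx.
- by rewrite adjmxM trmxCK -mulmxA (mulmxA W) Ce mulmx0.
split; rewrite AE.
- by rewrite -mulmxA (mulmxA W) WW mul1mx.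
- by rewrite -mulmxA (mulmxA W) Ce mulmx0.
- by rewrite adjmxM -mulmxA (mulmxA _ S) SS mul1mx.
- by rewrite adjmxM -mulmxA (mulmxA (S^t*)) -adjmxM C'e mulmx0.
Qed.

End CircleStructure.

(** * The numerical range *)

Section NumericalRange.
Local Open Scope complex_scope.
Variable R : realType.
Local Notation K := R[i].

(** The hypothesis is only used for e = N / (M + 1). *)
Lemma quadratic_ge0_linear (N M : K) : 0 <= N -> 0 <= M ->
  (forall e, 0 <= e -> 0 <= e ^+ 2 * M - 2 * e * N) -> N = 0.
Proof.
move=> N0 M0 H.
have [e e0 NE] : exists2 e, 0 <= e & N = e * (M + 1).
  exists (N / (M + 1)); first by rewrite divr_ge0 // addr_ge0.
  by rewrite mulfVK // gt_eqF // ltr_wpDl.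
have {H} := H e e0; have -> : e ^+ 2 * M - 2 * e * N = - (e ^+ 2 * (M + 2)).
  by rewrite NE; ring.
rewrite oppr_ge0 => H.
have M2 : 0 < M + 2 by rewrite ltr_wpDl.
have : e ^+ 2 * (M + 2) = 0.
  by apply: le_anti; rewrite H mulr_ge0 ?exprn_ge0 // ltW.
move/eqP; rewrite mulf_eq0 (gt_eqF M2) orbF expf_eq0 /= => /eqP e00.
by rewrite NE e00 mul0r.
Qed.

(** A vector on which a positive semidefinite form vanishes lies in its kernel. *)
Lemma psd_null_vector n (G : 'M[K]_n) (x : 'cV[K]_n) : G^t* = G ->
  (forall y : 'cV_n, 0 <= (y^t* *m (G *m y)) 0 0) ->
  (x^t* *m (G *m x)) 0 0 = 0 -> G *m x = 0.
Proof.
move=> GG Gpos xGx; set y := G *m x; apply: gram_eq0.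
apply: (quadratic_ge0_linear (gram_ge0 y) (Gpos y)) => e e0.
have eR : Num.conj e = e by apply/CrealP/ger0_real.
have := Gpos (x - e *: y).
rewrite adjmxB adjmxZ eR mulmxBr mulmxBl !mulmxBr -!scalemxAr -!scalemxAl.
have -> : x^t* *m (G *m y) = y^t* *m y by rewrite mulmxA -{1}GG -adjmxM.
rewrite -/y !(addmxE, oppmxE, scalemxE) xGx.
move: ((y^t* *m y) 0 0) ((y^t* *m _) 0 0) => N M H.
apply: le_trans H _; rewrite le_eqVlt; apply/orP; left; apply/eqP.
by ring.
Qed.

Lemma inner_eq1 n (x : 'cV[K]_n) : vnorm x = 1 <-> (x^t* *m x) 0 0 = 1.
Proof.
rewrite /vnorm /inner; split=> [|->]; last exact: sqrtC1.
by move=> /(congr1 (fun z => z ^+ 2)); rewrite sqrtCK expr1n.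
Qed.

Lemma unit_multiple n (x : 'cV[K]_n) : x != 0 ->
  exists c : K, ((c *: x)^t* *m (c *: x)) 0 0 = 1 /\
    forall B : 'M_n, ((c *: x)^t* *m (B *m (c *: x))) 0 0 =
                     (x^t* *m (B *m x)) 0 0 / (x^t* *m x) 0 0.
Proof.
move=> x0; set N := (x^t* *m x) 0 0.
have N0 : 0 < N.
  rewrite lt_def gram_ge0 andbT; apply: contraNneq x0 => H.
  by rewrite [x]gram_eq0.
have sR : Num.conj (sqrtC N)^-1 = (sqrtC N)^-1.
  by apply/CrealP/ger0_real; rewrite invr_ge0 sqrtC_ge0 ltW.
exists (sqrtC N)^-1.
have scale B : (((sqrtC N)^-1 *: x)^t* *m (B *m ((sqrtC N)^-1 *: x))) 0 0
    = (x^t* *m (B *m x)) 0 0 / N.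
  rewrite adjmxZ sR -!(scalemxAl, scalemxAr) !scalemxE mulrA -invfM -expr2 sqrtCK.
  by rewrite mulrC.
by split=> //; have := scale 1%:M; rewrite !mul1mx => ->; rewrite divff // gt_eqF.
Qed.

Lemma numerical_range_quotient n (A : 'M[K]_n) (x : 'cV_n) : x != 0 ->
  numerical_range A ((x^t* *m (A *m x)) 0 0 / (x^t* *m x) 0 0).
Proof.
move=> /unit_multiple[c [c1 cB]]; exists (c *: x); first exact/inner_eq1.
by rewrite /inner cB.
Qed.

Lemma disk_range_bound n (A : 'M[K]_n) a (r : R) :
  numerical_range A = disk a r -> forall x : 'cV_n,
  `|(x^t* *m ((A - a%:M) *m x)) 0 0| <= r%:C * (x^t* *m x) 0 0.
Proof.
move=> WE x; have [->|x0] := eqVneq x 0.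
  by rewrite !mulmx0 !mxE normr0 mulr0.
have := numerical_range_quotient A x0; rewrite WE /disk /=; set N := (x^t* *m x) 0 0.
have N0 : 0 < N.
  rewrite lt_def gram_ge0 andbT; apply: contraNneq x0 => H.
  by rewrite [x]gram_eq0.
have -> : (x^t* *m (A *m x)) 0 0 / N - a = (x^t* *m ((A - a%:M) *m x)) 0 0 / N.
  rewrite mulmxBl mulmxBr mul_scalar_mx -(scalemxAr a).
  by rewrite !(addmxE, oppmxE, scalemxE) -/N mulrBl mulfK // gt_eqF.
by rewrite normrM normfV (gtr0_norm N0) ler_pdivrMr.
Qed.

Lemma Re_mx_form n (B : 'M[K]_n) t (x : 'cV_n) :
  (x^t* *m (Re_mx (expi t *: B) *m x)) 0 0 =
  'Re (expi t * (x^t* *m (B *m x)) 0 0).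
Proof.
rewrite /Re_mx adjmxZ -scalemxAl mulmxDl -!scalemxAl -scalemxAr mulmxDr -!scalemxAr.
rewrite !(addmxE, scalemxE) ReE rmorphM mulrC; congr ((_ + _ * _) / _).
have -> : x^t* *m (B^t* *m x) = (x^t* *m (B *m x))^t*.
  by rewrite !adjmxM trmxCK mulmxA.
by rewrite mxE [_^T _ _]mxE.
Qed.

Lemma Re_mx_adj n (B : 'M[K]_n) : (Re_mx B)^t* = Re_mx B.
Proof.
rewrite /Re_mx adjmxZ adjmxD trmxCK addrC; congr (_ *: _).
by rewrite fmorphV rmorph_nat.
Qed.

(** If the numerical range is a disk, its boundary circle lies on the curve. *)
Lemma disk_range_curve n (A : 'M[K]_n) a (r : R) : 0 < r ->
  numerical_range A = disk a r -> curve_contains A a r.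
Proof.
move=> r0 WE; apply/curve_contains0P => // t.
have bound := disk_range_bound WE; set B := A - a%:M in bound *.
have expi_norm : `|expi t : K| = 1.
  apply/eqP; rewrite -(@eqrXn2 _ 2) ?ler01 // expr1n.
  by apply/eqP; rewrite normCK expi_conjM.
(* For e = 1 and e = -1, the point a + e r exp(- i t) of the disk is attained by
   a unit vector, which is extremal for the form of Re (exp(i t) B). *)
have key (e : R) : e ^+ 2 = 1 ->
    \det (Re_mx (expi t *: B) - (e%:C * r%:C)%:M) = 0.
  move=> e1.
  have e1' : e%:C * e%:C = 1 :> K by rewrite -rmorphM -expr2 e1 rmorph1.
  have eN : `|e%:C : K| = 1.
    apply/eqP; rewrite -(@eqrXn2 _ 2) ?ler01 // expr1n.
    by apply/eqP; rewrite normCK conj_real e1'.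
  pose z := a + e%:C * r%:C * Num.conj (expi t).
  have : numerical_range A z.
    rewrite WE /disk /= /z addrC addKr normrM norm_conjC expi_norm mulr1 normrM eN mul1r.
    by rewrite ger0_norm // ler0c ltW.
  case=> x /inner_eq1 xx; rewrite /inner => zE.
  have xBx : (x^t* *m (B *m x)) 0 0 = e%:C * r%:C * Num.conj (expi t).
    rewrite mulmxBl mulmxBr mul_scalar_mx -(scalemxAr a).
    by rewrite !(addmxE, oppmxE, scalemxE) xx -zE /z mulr1 addrC addKr.
  pose G : 'M[K]_n := (r%:C)%:M - e%:C *: Re_mx (expi t *: B).
  have Gform (y : 'cV_n) : (y^t* *m (G *m y)) 0 0 =
      r%:C * (y^t* *m y) 0 0 - e%:C * 'Re (expi t * (y^t* *m (B *m y)) 0 0).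
    rewrite mulmxBl mulmxBr mul_scalar_mx.
    rewrite -(scalemxAl e%:C) -(scalemxAr r%:C) -(scalemxAr e%:C).
    by rewrite !(addmxE, oppmxE, scalemxE) Re_mx_form.
  have Gx : G *m x = 0.
    apply: psd_null_vector.
    - by rewrite adjmxB adjmxZ adjmx_scalar Re_mx_adj !conj_real.
    - move=> y; rewrite Gform subr_ge0; apply: le_trans (bound y).
      set q := (y^t* *m _) 0 0; rewrite -ReMl; last by apply/complex_realP; exists e.
      apply: le_trans (leif_Re_Creal _).1 _.
      by rewrite !normrM expi_norm eN !mul1r.
    - rewrite Gform xx xBx mulrCA expi_conjM !mulr1.
      have -> : 'Re (e%:C * r%:C : K) = e%:C * r%:C.
        by apply/Creal_ReP; rewrite rpredM //; apply/complex_realP; [exists e | exists r].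
      by rewrite mulrA e1' mul1r subrr.
  apply/eqP/det0_colP; exists x.
    by apply/eqP => x0; move: xx; rewrite x0 mulmx0 mxE => /eqP; rewrite eq_sym oner_eq0.
  have -> : Re_mx (expi t *: B) - (e%:C * r%:C)%:M = (- e%:C) *: G.
    rewrite /G; move: (Re_mx _) => H.
    rewrite scalerBr scalerA mulNr e1' scaleN1r opprK addrC.
    by rewrite -scale_scalar_mx scaleNr.
  by rewrite -scalemxAl Gx scaler0.
split; first by have := key 1 (expr1n _ _); rewrite mul1r.
by have := key (-1) (etrans (sqrrN 1) (expr1n _ _)); rewrite rmorphN rmorph1 mulN1r.
Qed.

Lemma unit_eigenvector n (C : 'M[K]_n) b : \det (C - b%:M) = 0 ->
  exists x : 'cV_n, (x^t* *m x) 0 0 = 1 /\ C *m x = b *: x.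
Proof.
move=> /eqP/det0_colP[x x0]; rewrite mulmxBl mul_scalar_mx => /eqP.
rewrite subr_eq0 => /eqP Cx; have [c [c1 _]] := unit_multiple x0.
by exists (c *: x); split=> //; rewrite -scalemxAr Cx !scalerA mulrC.
Qed.

(** Given a unit vector x with C x = v x and v nonzero, the vector W^H x + o S x for
    a suitable phase o has a Rayleigh quotient of modulus (1 + |v|) / 2. *)
Lemma defect1_range_point n (A : 'M[K]_n) : partial_isometry A ->
  \rank A = 3%N -> defect A = 1%N ->
  exists2 z : K, numerical_range A z & 1 / 2 < `|z|.
Proof.
move=> piA rA defA.
have [S [W [AE SS WW C0]]] := defect1_factor piA rA defA.
have := det_compression_drsub AE rA defA C0.
set b := (W *m S) (inord 1) (inord 1); set z := (W *m S) (inord 1) (inord 2).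
set w := (W *m S) (inord 2) (inord 1); set c := (W *m S) (inord 2) (inord 2).
move=> D0.
(* v is a root of the characteristic polynomial of the invertible 2x2 corner. *)
have [v vE] :=
  @solve_monicpoly K 2 (fun i => if i is 0%N then z * w - b * c else b + c) isT.
move: vE; rewrite !big_ord_recl big_ord0 /= expr0 expr1 mulr1 addr0 => vE.
have v0 : v != 0.
  apply: contraNneq D0 => v0; move: vE; rewrite v0 expr0n /= mulr0 addr0 => /esym/eqP.
  by rewrite subr_eq0 eq_sym -subr_eq0.
have detv : \det (W *m S - v%:M) = 0.
  have C0' i : (W *m S) i (inord 0) = 0.
    by rewrite -[RHS](C0 i); congr ((_ *m _) _ _); apply: val_inj; rewrite /= inordK.
  rewrite det3 !(addmxE, oppmxE) !C0' -/b -/z -/w -/c.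
  rewrite ![_%:M _ _]mxE -!(inj_eq val_inj) /= !inordK //= ?mulr1n ?mulr0n.
  rewrite !(subr0, sub0r, mul0r, mulr0) mulNr.
  have -> : (b - v) * (c - v) - z * w = 0.
    have -> : (b - v) * (c - v) - z * w = v ^+ 2 - (z * w - b * c + (b + c) * v).
      by ring.
    by rewrite vE subrr.
  by rewrite !(oppr0, mulr0, addr0, subr0).
have [x [xx Cx]] := unit_eigenvector detv.
pose h := `|v|; have h0 : 0 < h by rewrite normr_gt0.
(* The phase o makes o v positive, so that W^H x and o S x add up coherently. *)
pose o := Num.conj v / h.
have hR : Num.conj h = h by apply/CrealP/ger0_real/ltW.
have ov : o * v = h by rewrite /o mulrAC [_ * v]mulrC -normCK expr2 mulfK ?gt_eqF.
have oo : Num.conj o * o = 1.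
  rewrite mulrC -normCK /o normrM norm_conjC normfV /h normr_id.
  by rewrite divff ?normr_eq0 // expr1n.
have vo : v = Num.conj o * h by rewrite -ov mulrA oo mul1r.
pose y := W^t* *m x + o *: (S *m x).
have Ay : A *m y = (1 + h) *: (S *m x).
  rewrite /y mulmxDr -scalemxAr AE -!mulmxA (mulmxA W (W^t*)) WW mul1mx.
  by rewrite (mulmxA W S) Cx -scalemxAr scalerA ov scalerDl scale1r.
have adjy : y^t* = x^t* *m W + Num.conj o *: (x^t* *m S^t*).
  by rewrite /y adjmxD adjmxZ !adjmxM trmxCK.
have xWSx : (x^t* *m W *m (S *m x)) 0 0 = v.
  by rewrite -mulmxA (mulmxA W) Cx -scalemxAr scalemxE xx mulr1.
have xSSx : (x^t* *m S^t* *m (S *m x)) 0 0 = 1.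
  by rewrite -mulmxA (mulmxA _ S) SS mul1mx.
have yAy : (y^t* *m (A *m y)) 0 0 = Num.conj o * (1 + h) ^+ 2.
  rewrite Ay adjy -scalemxAr mulmxDl -scalemxAl !(addmxE, scalemxE) xWSx xSSx {1}vo.
  by ring.
have cov : Num.conj o * Num.conj v = h.
  by rewrite -[RHS]hR -[in RHS]ov; apply/esym/rmorphM.
have xSWx : (x^t* *m S^t* *m (W^t* *m x)) 0 0 = Num.conj v.
  have -> : x^t* *m S^t* *m (W^t* *m x) = (x^t* *m W *m (S *m x))^t*.
    by rewrite !adjmxM trmxCK !mulmxA.
  by rewrite mxE [_^T _ _]mxE xWSx.
have xWWx : (x^t* *m W *m (W^t* *m x)) 0 0 = 1.
  by rewrite -mulmxA (mulmxA W) WW mul1mx.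
have yy : (y^t* *m y) 0 0 = 2 * (1 + h).
  rewrite {2}/y adjy mulmxDl !mulmxDr -!(scalemxAl, scalemxAr) !(addmxE, scalemxE).
  rewrite xWWx xSWx xWSx xSSx ov mulr1 oo cov.
  by ring.
have h1 : 0 < 1 + h by rewrite ltr_wpDl.
have y0 : y != 0.
  apply: contra_eq_neq yy => ->; rewrite mulmx0 mxE eq_sym mulf_neq0 ?pnatr_eq0 //.
  by rewrite gt_eqF.
exists (Num.conj o * (1 + h) / 2).
  have := numerical_range_quotient A y0; rewrite yAy yy.
  suff -> : Num.conj o * (1 + h) ^+ 2 / (2 * (1 + h)) = Num.conj o * (1 + h) / 2 by [].
  by have h1' : 1 + h != 0 by [rewrite gt_eqF]; field.
have o1 : `|o| = 1.
  apply/eqP; rewrite -(@eqrXn2 _ 2) ?ler01 // expr1n.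
  by rewrite normCK mulrC oo.
rewrite !normrM norm_conjC o1 !mul1r (gtr0_norm h1) normfV ger0_norm ?ler0n //.
by rewrite ltr_pMl ?invr_gt0 ?ltr0n // ltrDl.
Qed.

End NumericalRange.

Theorem theorem5p2 (R : realType) (n : nat) (A : 'M[R[i]]_n) :
  partial_isometry A -> \rank A = 3%N -> defect A = 1%N ->
  [/\ curve_contains_circle A <-> unitarily_reducible_with A J2,
      (curve_contains_circle A ->
         exists a : R[i],
           curve_contains A a (1 / 2) /\
           forall (b : R[i]) (r : R), 0 < r ->
             curve_contains A b r -> b = a /\ r = 1 / 2)
    & ~ circular_disk (numerical_range A)].
Proof.
move=> piA rA defA; have circ := circle_structure piA rA defA.
split.
- split=> [[a [r r0 /circ[]]]|] // /reducible_J2_pair[f [g [fg f0]]].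
  by exists 0, (1 / 2); [rewrite divr_gt0 | exact: J2_pair_curve fg f0].
- move=> [a [r r0 ar]]; have [a0 rE _] := circ _ _ r0 ar.
  exists 0; split=> [|b r' r'0 /circ[]//]; by rewrite -a0 -rE.
- move=> [a [r r0 WE]].
  have [a0 rE _] := circ _ _ r0 (disk_range_curve r0 WE).
  have [z] := defect1_range_point piA rA defA; rewrite WE /disk /= a0 subr0 rE => le lt.
  have := lt_le_trans lt le.
  by rewrite rmorphM rmorph1 fmorphV (rmorph_nat (real_complex R) 2) ltxx.
Qed.
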